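(* Let $F: \mathbb{R}^m \to \mathbb{R}^n$ be a bounded (possibly discontinuous) semialgebraic function. Then there exist $\mathcal{N} \in ISDnet(m,n,1)$ and $c_{\max} \ge 0$ such that $\mathrm{SANN}^{lim}(\mathcal{N}, x, c_{\max}) = F(x)$ for all $x\in\mathbb{R}^m$.
   Context: For $D \subseteq \mathbb{R}^N$, $ISD(D)$ is the smallest set of functions $D \to \mathbb{R}$ containing all restrictions of real polynomials and closed under pointwise $\min$ and $\max$; vector/matrix-valued functions are ISD if all entries are. $ISDnet(m,n,k) := ISD(\mathbb{R}^m\times\mathbb{R}^{n+k}\times\mathbb{R},\ \mathbb{R}^{(n+k)\times(n+k)}\times\mathbb{R}^{n+k})$; for $\mathcal N$ in it write $\mathcal N(x,z,s) = (M(x,z,s), b(x,z,s))$. For $c\ge 0$, $\mathrm{clamp\text{-}sol}_c(M,b) := \mathrm{clamp}(M^{-1}b,-c,c)$ if $M$ is invertible and $0$ otherwise, with clamp applied componentwise ($a_i\mapsto\min(\max(a_i,-c),c)$). $\mathrm{SANN}^{lim}(\mathcal N,x,c_{\max})$ is the vector of the first $n$ components of $z(1)$, where $z:[0,1]\to\mathbb{R}^{n+k}$ is the (exact) solution of $\dot z(s) = \mathrm{clamp\text{-}sol}_{c_{\max}}(M(x,z(s),s), b(x,z(s),s))$, $z(0)=0$. A semialgebraic function is one whose graph is a semialgebraic set. *)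

(* Defs.v *)
From HB Require Import structures.
From mathcomp Require Import all_boot all_order all_algebra.
From mathcomp Require Import all_classical all_reals all_analysis.
Set Implicit Arguments. Unset Strict Implicit. Unset Printing Implicit Defensive.
Import Order.TTheory GRing.Theory Num.Theory.
Import numFieldNormedType.Exports.
Local Open Scope classical_set_scope.
Local Open Scope ring_scope.

Section Defs.
Variable R : realType.

(* Polynomial functions R^N -> R (R^N represented by column vectors 'cV_N):
   the smallest set containing constants and coordinates, closed under + and *.
   These are exactly the functions v |-> p(v) for real polynomials p. *)
Inductive poly_fun (N : nat) : ('cV[R]_N -> R) -> Prop :=
| pf_const (c : R) : poly_fun (fun _ => c)
| pf_coord (i : 'I_N) : poly_fun (fun v => v i ord0)
| pf_add f g : poly_fun f -> poly_fun g -> poly_fun (fun v => f v + g v)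
| pf_mul f g : poly_fun f -> poly_fun g -> poly_fun (fun v => f v * g v).

Inductive isd (N : nat) : ('cV[R]_N -> R) -> Prop :=
| isd_poly f : poly_fun f -> isd f
| isd_min f g : isd f -> isd g -> isd (fun v => Num.min (f v) (g v))
| isd_max f g : isd f -> isd g -> isd (fun v => Num.max (f v) (g v)).

Inductive semialg_set (N : nat) : set 'cV[R]_N -> Prop :=
| sa_pos p : poly_fun p -> semialg_set [set v | 0 < p v]
| sa_zero p : poly_fun p -> semialg_set [set v | p v = 0]
| sa_union A B : semialg_set A -> semialg_set B -> semialg_set (A `|` B)
| sa_inter A B : semialg_set A -> semialg_set B -> semialg_set (A `&` B)
| sa_compl A : semialg_set A -> semialg_set (~` A).

Definition semialg_fun (m n : nat) (F : 'cV[R]_m -> 'cV[R]_n) : Prop :=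
  semialg_set [set v : 'cV[R]_(m + n) | F (usubmx v) = dsubmx v].

Definition net_input (m p : nat) (x : 'cV[R]_m) (z : 'cV[R]_p) (s : R)
  : 'cV[R]_(m + p + 1) := col_mx (col_mx x z) (const_mx s).

Definition isdnet (m n k : nat)
  (M : 'cV[R]_(m + (n + k) + 1) -> 'M[R]_(n + k))
  (b : 'cV[R]_(m + (n + k) + 1) -> 'cV[R]_(n + k)) : Prop :=
  (forall i j, isd (fun v => M v i j)) /\ (forall i, isd (fun v => b v i ord0)).

Definition clamp (c a : R) : R := Num.min (Num.max a (- c)) c.

Definition clamp_sol (p : nat) (c : R) (M : 'M[R]_p) (b : 'cV[R]_p) : 'cV[R]_p :=
  if M \in unitmx then map_mx (clamp c) (invmx M *m b) else 0.

Definition sann_solution (m n k : nat)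
  (M : 'cV[R]_(m + (n + k) + 1) -> 'M[R]_(n + k))
  (b : 'cV[R]_(m + (n + k) + 1) -> 'cV[R]_(n + k))
  (x : 'cV[R]_m) (cmax : R) (z : R -> 'cV[R]_(n + k)) : Prop :=
  [/\ z 0 = 0,
      {within `[0, 1]%classic, continuous z} &
      forall s : R, 0 < s < 1 ->
        is_derive s 1 z
          (clamp_sol cmax (M (net_input x (z s) s)) (b (net_input x (z s) s)))].

Definition sann_lim_eq (m n k : nat)
  (M : 'cV[R]_(m + (n + k) + 1) -> 'M[R]_(n + k))
  (b : 'cV[R]_(m + (n + k) + 1) -> 'cV[R]_(n + k))
  (x : 'cV[R]_m) (cmax : R) (y : 'cV[R]_n) : Prop :=
  (exists z, sann_solution M b x cmax z) /\
  (forall z, sann_solution M b x cmax z -> usubmx (z 1) = y).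

End Defs.

(* Main.v *)
(** A semialgebraic graph is a finite union of pieces [g_i = 0 < h_i] with
    [g_i, h_i] ISD and [g_i >= 0].  The straight line [z(s) = s F(x)],
    [w(s) = s (i + 1)], where [i] is the index of a piece containing
    [(x, F x)], is made a solution of a field which is [z' = z / s] wherever
    the system matrix is invertible, and which rules out every other solution.

    The matrix is invertible only if the ratio [w / s] lies strictly inside a
    unit interval ("slot") centred at some [i + 1] with [h_i(x, z / s) > 0], or
    below all the slots; there [w' >= 1 / 2], while [w' = 0] where the matrix
    is singular.  Since a derivative has the intermediate value property, the
    matrix is invertible along the whole of any solution.  So [z / s] is a
    constant [y], and [w / s], unable to cross the walls between slots, stays
    in one slot.  If [g_i(x, y) > 0], or if [w / s] lies below all the slots,
    then [w' - w / s] is bounded below by a positive constant, which makes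
    [w / s] unbounded as [s] tends to [0]; this contradicts [|w'| <= c].  Hence
    [g_i(x, y) = 0 < h_i(x, y)], that is [y = F x]. *)

Require Import Defs.
From HB Require Import structures.
From mathcomp Require Import all_boot all_order all_algebra.
From mathcomp Require Import all_classical all_reals all_analysis.
From mathcomp Require Import ring lra.
Set Implicit Arguments. Unset Strict Implicit. Unset Printing Implicit Defensive.
Import Order.TTheory GRing.Theory Num.Theory.
Import numFieldNormedType.Exports.
Local Open Scope classical_set_scope.
Local Open Scope ring_scope.

(** * ISD functions and semialgebraic sets *)

Section IsdRing.
Context {R : realType} {N : nat}.
Implicit Types f g : 'cV[R]_N -> R.

Lemma isd_const (c : R) : isd (fun _ : 'cV[R]_N => c).
Proof. exact/isd_poly/pf_const. Qed.

Lemma isd_coord (i : 'I_N) : isd (fun v : 'cV[R]_N => v i ord0).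
Proof. exact/isd_poly/pf_coord. Qed.

Lemma eq_isd f g : f =1 g -> isd g -> isd f.
Proof. by move=> /funext ->. Qed.

(** Adding a common term commutes with [min] and [max], so the sum can be pushed down to the
    polynomial leaves, first of [f] and then of [g]. *)
Lemma isd_add f g : isd f -> isd g -> isd (fun v => f v + g v).
Proof.
move=> If Ig; elim: If => [{}f pf|f1 f2 _ I1 _ I2|f1 f2 _ I1 _ I2].
- elim: Ig => [{}g pg|g1 g2 _ I1 _ I2|g1 g2 _ I1 _ I2].
  + exact/isd_poly/pf_add.
  + rewrite (_ : (fun _ => _) = fun v => Num.min (f v + g1 v) (f v + g2 v)).
      exact: isd_min.
    by apply/funext => v; rewrite addr_minr.
  + rewrite (_ : (fun _ => _) = fun v => Num.max (f v + g1 v) (f v + g2 v)).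
      exact: isd_max.
    by apply/funext => v; rewrite addr_maxr.
- rewrite (_ : (fun _ => _) = fun v => Num.min (f1 v + g v) (f2 v + g v)).
    exact: isd_min.
  by apply/funext => v; rewrite addr_minl.
- rewrite (_ : (fun _ => _) = fun v => Num.max (f1 v + g v) (f2 v + g v)).
    exact: isd_max.
  by apply/funext => v; rewrite addr_maxl.
Qed.

Lemma isd_opp f : isd f -> isd (fun v => - f v).
Proof.
elim=> [{}f pf|f1 f2 _ I1 _ I2|f1 f2 _ I1 _ I2].
- rewrite (_ : (fun _ => _) = fun v => -1 * f v).
    exact/isd_poly/pf_mul/pf/pf_const.
  by apply/funext => v; rewrite mulN1r.
- rewrite (_ : (fun _ => _) = fun v => Num.max (- f1 v) (- f2 v)).
    exact: isd_max.
  by apply/funext => v; rewrite oppr_min.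
- rewrite (_ : (fun _ => _) = fun v => Num.min (- f1 v) (- f2 v)).
    exact: isd_min.
  by apply/funext => v; rewrite oppr_max.
Qed.

(* The factors [1 + q * q] and [1 + p * p] dominate [q] and [p], so the minimum
   is [p * q] when both are nonnegative and nonpositive otherwise. *)
Lemma posM_poly (p q : R) : Num.max 0 p * Num.max 0 q =
  Num.max 0 (Num.min (p * q) (Num.min (p * (1 + q * q)) (q * (1 + p * p)))).
Proof.
have [p0|p0] := leP 0 p; last first.
  rewrite mul0r; symmetry; apply/max_idPl; rewrite !ge_min; apply/orP; right.
  by apply/orP; left; nra.
have [q0|q0] := leP 0 q; last first.
  rewrite mulr0; symmetry; apply/max_idPl; rewrite !ge_min; apply/orP; right.
  by apply/orP; right; nra.
rewrite [X in Num.max 0 X]min_l; first by rewrite max_r// mulr_ge0.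
have sq : 0 <= (p - 1/2)^+2 by exact: sqr_ge0.
have sp : 0 <= (q - 1/2)^+2 by exact: sqr_ge0.
rewrite le_min; apply/andP; split.
  by rewrite ler_wpM2l//; lra.
by rewrite mulrC ler_wpM2l//; lra.
Qed.

(** Multiplication commutes with [min] and [max] only when the other factor is nonnegative; positive
    parts ensure this, and [posM_poly] settles the polynomial leaves. *)
Lemma isd_posM f g : isd f -> isd g ->
  isd (fun v => Num.max 0 (f v) * Num.max 0 (g v)).
Proof.
move=> If Ig; elim: If => [{}f pf|f1 f2 _ I1 _ I2|f1 f2 _ I1 _ I2].
- elim: Ig => [{}g pg|g1 g2 _ I1 _ I2|g1 g2 _ I1 _ I2].
  + apply: (eq_isd (fun v => posM_poly (f v) (g v))).
    apply: isd_max; first exact: isd_const.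
    apply: isd_min; first exact/isd_poly/pf_mul.
    by apply: isd_min; apply/isd_poly; do ?[exact: pf_const | apply: pf_mul
      | apply: pf_add].
  + rewrite (_ : (fun _ => _) = fun v => Num.min
      (Num.max 0 (f v) * Num.max 0 (g1 v)) (Num.max 0 (f v) * Num.max 0 (g2 v))).
      exact: isd_min.
    by apply/funext => v; rewrite max_minr minr_pMr// le_max lexx.
  + rewrite (_ : (fun _ => _) = fun v => Num.max
      (Num.max 0 (f v) * Num.max 0 (g1 v)) (Num.max 0 (f v) * Num.max 0 (g2 v))).
      exact: isd_max.
    apply/funext => v; rewrite -maxr_pMr ?le_max ?lexx//; congr (_ * _).
    by rewrite maxACA maxxx.
- rewrite (_ : (fun _ => _) = fun v => Num.min
      (Num.max 0 (f1 v) * Num.max 0 (g v)) (Num.max 0 (f2 v) * Num.max 0 (g v))).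
    exact: isd_min.
  by apply/funext => v; rewrite max_minr minr_pMl// le_max lexx.
- rewrite (_ : (fun _ => _) = fun v => Num.max
      (Num.max 0 (f1 v) * Num.max 0 (g v)) (Num.max 0 (f2 v) * Num.max 0 (g v))).
    exact: isd_max.
  apply/funext => v; rewrite -maxr_pMl ?le_max ?lexx//; congr (_ * _).
  by rewrite maxACA maxxx.
Qed.

(** Splitting each factor into positive and negative parts leaves four products covered by
    [isd_posM]. *)
Lemma isd_mul f g : isd f -> isd g -> isd (fun v => f v * g v).
Proof.
move=> If Ig; have [Nf Ng] := (isd_opp If, isd_opp Ig).
rewrite (_ : (fun _ => _) = fun v =>
  (Num.max 0 (f v) * Num.max 0 (g v) + Num.max 0 (- f v) * Num.max 0 (- g v)) +
  - (Num.max 0 (f v) * Num.max 0 (- g v) + Num.max 0 (- f v) * Num.max 0 (g v))).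
  by apply: isd_add; [|apply: isd_opp]; apply: isd_add; exact: isd_posM.
have posE (a : R) : a = Num.max 0 a - Num.max 0 (- a).
  have [a0|a0] := leP 0 a.
    by rewrite max_l ?oppr_le0// subr0.
  by rewrite max_r ?oppr_ge0 ?ltW// sub0r opprK.
by apply/funext => v; rewrite {1}(posE (f v)) {1}(posE (g v)); ring.
Qed.

Lemma isd_exp f d : isd f -> isd (fun v => f v ^+ d).
Proof.
move=> If; elim: d => [|d IH]; first exact: isd_const.
rewrite (_ : (fun _ => _) = fun v => f v * f v ^+ d); first exact: isd_mul.
by apply/funext => v; rewrite exprS.
Qed.

Lemma isd_sum (I : Type) (r : seq I) (f : I -> 'cV[R]_N -> R) :
  (forall i, isd (f i)) -> isd (fun v => \sum_(i <- r) f i v).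
Proof.
move=> If; elim: r => [|i r IH].
  rewrite (_ : (fun _ => _) = fun=> 0); first exact: isd_const.
  by apply/funext => v; rewrite big_nil.
rewrite (_ : (fun _ => _) = fun v => f i v + \sum_(i <- r) f i v).
  exact: isd_add.
by apply/funext => v; rewrite big_cons.
Qed.

End IsdRing.

(** * Semialgebraic sets as finite unions of ISD pieces *)

Section DisjunctiveNormalForm.
Context {R : realType} {N : nat}.

(** Each piece has a single equation and a single strict inequality. The condition [0 <= g i v]
    allows equations to be conjoined by addition, and later fixes the sign of the perturbation of
    the field. *)
Definition isd_dnf (A : set 'cV[R]_N) : Prop :=
  exists (I : finType) (g h : I -> 'cV[R]_N -> R),
    [/\ forall i, isd (g i), forall i, isd (h i), forall i v, 0 <= g i v &
        forall v, A v <-> exists i, g i v = 0 /\ 0 < h i v].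

Lemma isd_dnf_basic (A : set 'cV[R]_N) g h : isd g -> isd h ->
  (forall v, 0 <= g v) -> (forall v, A v <-> (g v = 0 /\ 0 < h v)) ->
  isd_dnf A.
Proof.
move=> Ig Ih g0 Agh; exists unit, (fun=> g), (fun=> h); split=> // v.
by rewrite Agh; split=> [|[]//]; exists tt.
Qed.

Lemma isd_dnfU (A B : set 'cV[R]_N) :
  isd_dnf A -> isd_dnf B -> isd_dnf (A `|` B).
Proof.
move=> [I [g [h [Ig Ih g0 Agh]]]] [J [k [l [Jk Jl k0 Bkl]]]].
exists (I + J)%type, (fun c => match c with inl i => g i | inr j => k j end),
  (fun c => match c with inl i => h i | inr j => l j end).
split; try by case.
move=> v; split=> [[/Agh[i ?]|/Bkl[j ?]]|[[i|j] ?]].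
- by exists (inl i).
- by exists (inr j).
- by left; apply/Agh; exists i.
- by right; apply/Bkl; exists j.
Qed.

Lemma isd_dnfI (A B : set 'cV[R]_N) :
  isd_dnf A -> isd_dnf B -> isd_dnf (A `&` B).
Proof.
move=> [I [g [h [Ig Ih g0 Agh]]]] [J [k [l [Jk Jl k0 Bkl]]]].
exists (I * J)%type, (fun c v => g c.1 v + k c.2 v),
  (fun c v => Num.min (h c.1 v) (l c.2 v)).
split=> [c|c|c v|v].
- exact: isd_add.
- exact: isd_min.
- exact: addr_ge0.
split=> [[/Agh[i [gi hi]] /Bkl[j [kj lj]]]|[[i j] /= []]].
  by exists (i, j); rewrite /= gi kj addr0 lt_min hi.
move=> /eqP; rewrite paddr_eq0// lt_min => /andP[/eqP gi /eqP kj] /andP[hi lj].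
by split; [apply/Agh; exists i | apply/Bkl; exists j].
Qed.

Lemma semialg_isd_dnf (A : set 'cV[R]_N) : semialg_set A -> isd_dnf A.
Proof.
(* Carrying the complement along turns complementation into a swap, and De Morgan handles unions and
   intersections. *)
move=> sA; suff [] : isd_dnf A /\ isd_dnf (~` A) by [].
elim: sA => [p pp|p pp|{}A B _ [A1 A2] _ [B1 B2]|{}A B _ [A1 A2] _ [B1 B2]|{}A _ []].
- split.
    apply: (@isd_dnf_basic _ (fun=> 0) p) => //; try exact: isd_const.
    + exact: isd_poly.
    + by move=> v; split=> [|[]].
  apply: (@isd_dnf_basic _ (fun v => Num.max 0 (p v)) (fun=> 1)) => //.
  + exact/isd_max/isd_poly/pp/isd_const.
  + exact: isd_const.
  + by move=> v; rewrite le_max lexx.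
  + move=> v /=; split=> [/negP|[+ _]]; first by rewrite -leNgt => /max_idPl.
    by move=> /max_idPl pv; apply/negP; rewrite -leNgt.
- split.
    apply: (@isd_dnf_basic _ (fun v => p v * p v) (fun=> 1)) => //.
    + exact/isd_poly/pf_mul.
    + exact: isd_const.
    + by move=> v; rewrite -expr2 sqr_ge0.
    + move=> v /=; split=> [->|[+ _]]; first by rewrite mulr0.
      by move=> /eqP; rewrite mulf_eq0 orbb => /eqP.
  apply: (@isd_dnf_basic _ (fun=> 0) (fun v => p v * p v)) => //.
  + exact: isd_const.
  + exact/isd_poly/pf_mul.
  + move=> v /=; split=> [/eqP pv|[_]]; first by rewrite -expr2 exprn_even_gt0.
    by rewrite -expr2 exprn_even_gt0// => /= /eqP.
- by split; [exact: isd_dnfU | rewrite setCU; exact: isd_dnfI].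
- by split; [exact: isd_dnfI | rewrite setCI; exact: isd_dnfU].
- by split=> //; rewrite setCK.
Qed.

End DisjunctiveNormalForm.

(** * Clearing the denominator of [z / s] *)

Section Homogenisation.
Context {R : realType} {m n : nat}.

Definition s_coord (v : 'cV[R]_(m + (n + 1) + 1)) : R := dsubmx v ord0 ord0.
Definition w_coord (v : 'cV[R]_(m + (n + 1) + 1)) : R :=
  dsubmx (dsubmx (usubmx v)) ord0 ord0.

Lemma s_coordE x u s : s_coord (net_input x u s) = s.
Proof. by rewrite /s_coord /net_input col_mxKd mxE. Qed.

Lemma w_coordE x u s : w_coord (net_input x u s) = dsubmx u ord0 ord0.
Proof. by rewrite /w_coord /net_input col_mxKu col_mxKd. Qed.

Lemma isd_s_coord : isd s_coord.
Proof.
rewrite (_ : s_coord = fun v => v (rshift _ ord0) ord0); first exact: isd_coord.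
by apply/funext => v; rewrite /s_coord mxE.
Qed.

Lemma isd_w_coord : isd w_coord.
Proof.
rewrite (_ : w_coord = fun v => v (lshift _ (rshift _ (rshift _ ord0))) ord0).
  exact: isd_coord.
by apply/funext => v; rewrite /w_coord !mxE.
Qed.

Definition homogenises d (q : 'cV[R]_(m + (n + 1) + 1) -> R)
    (f : 'cV[R]_(m + n) -> R) :=
  forall x (u : 'cV[R]_(n + 1)) s, 0 < s ->
    q (net_input x u s) = s ^+ d * f (col_mx x (s^-1 *: usubmx u)).

(** Coordinates of [x] have degree 0 and those of [y] degree 1. Sums, minima and maxima are first
    brought to the common degree [d1 + d2]; powers of [s > 0] pass through [min] and [max]. *)
Lemma isd_homogenise f : isd f -> exists d q, isd q /\ homogenises d q f.
Proof.
have Is (d : nat) q : isd q -> isd (fun v => s_coord v ^+ d * q v).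
  exact/isd_mul/isd_exp/isd_s_coord.
elim=> [{}f|f1 f2 _ [d1 [q1 [I1 h1]]] _ [d2 [q2 [I2 h2]]]
           |f1 f2 _ [d1 [q1 [I1 h1]]] _ [d2 [q2 [I2 h2]]]].
- elim=> [c|i|f1 f2 _ [d1 [q1 [I1 h1]]] _ [d2 [q2 [I2 h2]]]
           |f1 f2 _ [d1 [q1 [I1 h1]]] _ [d2 [q2 [I2 h2]]]].
  + exists 0, (fun=> c); split; first exact: isd_const.
    by move=> x u s s0; rewrite expr0 mul1r.
  + rewrite -(splitK i); case: (fintype.split i) => j /=.
      exists 0, (fun v => v (lshift _ (lshift _ j)) ord0).
      split; first exact: isd_coord.
      by move=> x u s s0; rewrite /net_input !col_mxEu mul1r.
    exists 1, (fun v => v (lshift _ (rshift _ (lshift _ j))) ord0).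
    split; first exact: isd_coord.
    move=> x u s s0; rewrite /net_input col_mxEu !col_mxEd expr1 !mxE mulrA.
    by rewrite divff ?mul1r// gt_eqF.
  + exists (d1 + d2)%N, (fun v => s_coord v ^+ d2 * q1 v + s_coord v ^+ d1 * q2 v).
    split; first exact: isd_add (Is _ _ _) (Is _ _ _).
    by move=> x u s s0; rewrite h1// h2// s_coordE exprD; ring.
  + exists (d1 + d2)%N, (fun v => q1 v * q2 v).
    split; first exact: isd_mul.
    by move=> x u s s0; rewrite h1// h2// exprD; ring.
- exists (d1 + d2)%N,
    (fun v => Num.min (s_coord v ^+ d2 * q1 v) (s_coord v ^+ d1 * q2 v)).
  split; first exact: isd_min (Is _ _ _) (Is _ _ _).
  move=> x u s s0; rewrite h1// h2// s_coordE !mulrA -!exprD addnC.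
  by rewrite minr_pMr// exprn_ge0// ltW.
- exists (d1 + d2)%N,
    (fun v => Num.max (s_coord v ^+ d2 * q1 v) (s_coord v ^+ d1 * q2 v)).
  split; first exact: isd_max (Is _ _ _) (Is _ _ _).
  move=> x u s s0; rewrite h1// h2// s_coordE !mulrA -!exprD addnC.
  by rewrite maxr_pMr// exprn_ge0// ltW.
Qed.

End Homogenisation.

(** * Derivatives of real functions *)

Section RealDerivatives.
Context {R : realType}.

Lemma is_derive_coord m n (f : R -> 'M[R]_(m, n)) (s : R) (D : 'M[R]_(m, n)) i j :
  is_derive s 1 f D -> is_derive s 1 (fun t => f t i j) (D i j).
Proof.
move=> fD; have df : derivable f s 1 by exact: ex_derive.
apply: DeriveDef; first exact: (derivable_mxP _ _ _).1.
by have := @derive_val _ _ _ _ _ _ _ fD; rewrite derive_mx// => <-; rewrite mxE.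
Qed.

Lemma is_derive_linear n (C : 'cV[R]_n) (s : R) : is_derive s 1 (fun t : R => t *: C) C.
Proof.
have dC (i : 'I_n) j : is_derive s 1 (fun t : R => (t *: C) i j) (C i j).
  rewrite (_ : (fun _ => _) = (C i j) \*: (@id R)); last first.
    by apply/funext => t; rewrite mxE mulrC.
  by have := is_deriveZ (C i j) (is_derive_id s (1 : R)); rewrite [_ *: 1]mulr1.
have df : derivable (fun t : R => t *: C) s 1.
  by apply/derivable_mxP => i j; exact: (@ex_derive _ _ _ _ _ _ _ (dC i j)).
apply: DeriveDef => //.
rewrite derive_mx//; apply/matrixP => i j; rewrite mxE.
exact: (@derive_val _ _ _ _ _ _ _ (dC i j)).
Qed.

Lemma derive_lt0_slope (f : R -> R) (x d : R) : is_derive x 1 f d -> d < 0 ->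
  exists2 e, 0 < e & forall h, h != 0 -> `|h| < e -> h^-1 * (f (h + x) - f x) < 0.
Proof.
move=> fd d0.
have : h^-1 *: ((f \o shift x) (h *: (1 : R)) - f x) @[h --> 0^'] --> d.
  have -> : d = 'D_1 f x by rewrite derive_val.
  exact: (@ex_derive _ _ _ _ _ _ _ fd).
move=> /cvgrPdist_lt /(_ (- d)); rewrite oppr_gt0 => /(_ d0).
move=> -[e /= e0 he]; exists e => // h h0 hlt.
have := he h; rewrite /ball_ /= sub0r normrN => /(_ hlt h0).
by rewrite [h *: 1]mulr1 => /ltr_normlP[]; rewrite /GRing.scale/=; lra.
Qed.

(** The function [f x - v * x] decreases at [a] and increases at [b], so its minimum on the segment
    is interior and its derivative vanishes there. *)
Lemma darboux_lt (f df : R -> R) (a b v : R) : a < b ->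
  (forall x, a <= x <= b -> is_derive x 1 f (df x)) ->
  df a < v < df b -> exists2 c, a < c < b & df c = v.
Proof.
move=> ab fdf /andP[av vb].
pose g x := f x - v * x.
have gdf x : a <= x <= b -> is_derive x 1 g (df x - v).
  move=> /fdf fx.
  have := @is_deriveB _ _ _ _ _ _ _ _ _ fx (is_deriveZ v (is_derive_id x (1 : R))).
  by rewrite [v *: _]mulr1.
have cg : {within `[a, b], continuous g}.
  apply: derivable_within_continuous => x; rewrite in_itv/= => /gdf gx.
  exact: ex_derive.
have [c /[!in_itv]/= cab cmin] := EVT_min (ltW ab) cg.
have ca : c != a.
  apply/eqP => ca.
  have [||e e0 he] := derive_lt0_slope (gdf a _); [lra|lra|].
  (* This increment is short enough for the slope estimate and does not leave the segment. *)
  pose h := Num.min (e / 2) (b - a).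
  have h0 : 0 < h by rewrite lt_min; apply/andP; split; lra.
  have he2 : h <= e / 2 by rewrite ge_min lexx.
  have hb : h <= b - a by rewrite ge_min lexx orbT.
  have := he h (lt0r_neq0 h0); rewrite gtr0_norm// pmulr_rlt0 ?invr_gt0//.
  have : g c <= g (h + a) by apply: cmin; rewrite in_itv/=; lra.
  by rewrite ca; lra.
have cb : c != b.
  apply/eqP => cb.
  (* The slope estimate applies to [- g] at [b], with a negative increment. *)
  have gN : is_derive b 1 (- g) (- (df b - v)) by apply: is_deriveN; apply: gdf; lra.
  have [|e e0 he] := derive_lt0_slope gN; first lra.
  pose h := Num.min (e / 2) (b - a).
  have h0 : 0 < h by rewrite lt_min; apply/andP; split; lra.
  have he2 : h <= e / 2 by rewrite ge_min lexx.
  have hb : h <= b - a by rewrite ge_min lexx orbT.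
  have hN0 : - h != 0 by rewrite oppr_eq0 gt_eqF.
  have := he (- h) hN0; rewrite normrN gtr0_norm// invrN mulNr oppr_lt0.
  rewrite pmulr_rgt0 ?invr_gt0// -[(- g) _]/(- g _) -[(- g) b]/(- g _).
  have : g c <= g (- h + b) by apply: cmin; rewrite in_itv/=; lra.
  by rewrite cb; lra.
have cab' : a < c < b by move: cab; rewrite !le_eqVlt (eq_sym a) (negbTE ca) (negbTE cb).
exists c => //.
have gc : is_derive c 1 g 0.
  apply: (@derive1_at_min _ _ a b) => //; first exact: ltW.
  - move=> t /[!in_itv]/= tab; have gt : is_derive t 1 g (df t - v) by apply: gdf; lra.
    exact: ex_derive.
  - by move=> t /[!in_itv]/= tab; apply: cmin; rewrite in_itv/=; lra.
have gc' : is_derive c 1 g (df c - v) by apply: gdf; lra.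
have := @derive_val _ _ _ _ _ _ _ gc; rewrite (@derive_val _ _ _ _ _ _ _ gc'); lra.
Qed.

Lemma darboux (f df : R -> R) (I : interval R) :
  (forall x, x \in I -> is_derive x 1 f (df x)) ->
  forall a b v, a \in I -> b \in I -> df a < v < df b ->
  exists2 c, c \in I & df c = v.
Proof.
move=> fdf a b v aI bI vab; have [ab|ba|abE] := ltgtP a b.
- have [|//|c cab <-] := darboux_lt ab (df := df) (f := f) (v := v).
    by move=> x xab; exact/fdf/(interval_is_interval aI bI).
  exists c => //; apply: (interval_is_interval aI bI).
  by lra.
- have [||c cab /oppr_inj <-] := darboux_lt ba (df := fun x => - df x)
      (f := - f) (v := - v).
  + by move=> x xab; exact/is_deriveN/fdf/(interval_is_interval bI aI).
  + by rewrite !ltrN2 andbC.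
  exists c => //; apply: (interval_is_interval bI aI).
  by lra.
- by move: vab; rewrite abE; lra.
Qed.

Lemma continuous_within_coord m n (A : set R) (f : R -> 'M[R]_(m, n)) i j :
  {within A, continuous f} -> {within A, continuous (fun t => f t i j)}.
Proof.
move=> fc t; apply: (@continuous_comp (subspace A) _ _ f (fun B => B i j)).
  exact: fc.
exact: coord_continuous.
Qed.

Lemma derive_bounded_le (f df : R -> R) (c : R) : f 0 = 0 ->
  {within `[0, 1], continuous f} ->
  (forall s : R, 0 < s < 1 -> is_derive s 1 f (df s)) ->
  (forall s : R, 0 < s < 1 -> `|df s| <= c) ->
  forall s : R, 0 < s < 1 -> `|f s| <= c * s.
Proof.
move=> f0 fc fdf dfc s /andP[s0 s1].
have [x||t tI] := @MVT _ f df _ _ s0.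
- by rewrite in_itv/= => ?; apply: fdf; lra.
- apply: continuous_subspaceW fc => t /=; rewrite !in_itv/=; lra.
move: tI; rewrite in_itv/= f0 !subr0 => tI ->.
by rewrite normrM (gtr0_norm s0) ler_pM2r//; apply: dfc; lra.
Qed.

(** In this form of the quotient rule, the sign of [f' - f / s] decides whether the ratio rises or
    falls. *)
Lemma is_derive_div_id (f : R -> R) (s d : R) : 0 < s -> is_derive s 1 f d ->
  is_derive s 1 (fun t => f t / t) ((d - f s / s) / s).
Proof.
move=> s0 fd; have sN0 : s != 0 by rewrite gt_eqF.
have iV : is_derive s 1 (fun t : R => t^-1) (- s ^- 2).
  apply: DeriveDef; first exact: (@derivableV _ _ id).
  by rewrite (@deriveV _ _ id)// derive_id [_ *: 1]mulr1.
have := @is_deriveM _ _ _ _ _ _ _ _ fd iV.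
move=> /is_derive_eq; apply; rewrite /GRing.scale/=; field; exact: sN0.
Qed.

(** The equation [f' = f / s] makes [f / s] constant on the open interval; continuity carries this
    to the endpoint 1, where no derivative is assumed. *)
Lemma eq_ratio (f : R -> R) : f 0 = 0 ->
  {within `[0, 1], continuous f} ->
  (forall s : R, 0 < s < 1 -> is_derive s 1 f (f s / s)) ->
  forall s : R, 0 < s <= 1 -> f s = s * f 1.
Proof.
move=> f0 fc fdf; pose y := f (1/2) / (1/2).
have half (s : R) : 0 < s < 1 -> f s / s = y.
  suff lt_eq a b : 0 < a -> a < b < 1 -> f a / a = f b / b.
    move=> s01; have [s2|s2|->//] := ltgtP s (1/2); [|symmetry]; apply: lt_eq; lra.
  move=> a0 /andP[ab b1].
  have gd (u : R) : a <= u <= b -> is_derive u 1 (fun t => f t / t) 0.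
    move=> uab; have u0 : 0 < u by lra.
    have := is_derive_div_id u0 (fdf u _); rewrite subrr mul0r; apply; lra.
  have [u||u _] := @MVT _ (fun t => f t / t) (fun=> 0) _ _ ab.
  - by rewrite in_itv/= => ?; apply: gd; lra.
  - apply: derivable_within_continuous => u; rewrite in_itv/= => /gd gu.
    exact: ex_derive.
  by rewrite mul0r => /eqP; rewrite subr_eq0 => /eqP.
(* The mean value theorem for [f t - y * t] asks for derivatives only inside []0, s[], so [s = 1] is
   included. *)
have fs (s : R) : 0 < s <= 1 -> f s = y * s.
  move=> /andP[s0 s1].
  pose g t := f t - y * t.
  have gd (t : R) : t \in `]0, s[ -> is_derive t 1 g 0.
    rewrite in_itv/= => ts; have t01 : 0 < t < 1 by lra.
    have := @is_deriveB _ _ _ _ _ _ _ _ _ (fdf _ t01) (is_deriveZ y (is_derive_id t (1 : R))).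
    by rewrite [y *: _]mulr1 half// subrr.
  have gc : {within `[0, s], continuous g}.
    move=> t; apply: cvgB.
      by apply: (@continuous_subspaceW _ _ _ _ _ _ fc) => u /=; rewrite !in_itv/=; lra.
    apply: cvgM; first exact: cvg_cst.
    by apply: continuous_subspaceT => u; exact: cvg_id.
  have [t _] := MVT s0 gd gc.
  by rewrite mul0r /g f0 !mulr0 subr0 subr0 => /eqP; rewrite subr_eq0 => /eqP.
by move=> s s01; rewrite fs// fs ?ltr01 ?lexx// mulr1 mulrC.
Qed.

(** The ratio has derivative at least [k / s], so each halving of the time lowers it by at least
    [k / 2]; repeated halving takes it below the bound [- c]. *)
Lemma ratio_escape (f df : R -> R) (a c k : R) : 0 < a -> 0 < k ->
  (forall s : R, 0 < s < a -> is_derive s 1 f (df s)) ->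
  (forall s : R, 0 < s < a -> f s / s + k <= df s) ->
  (forall s : R, 0 < s < a -> `|f s| <= c * s) -> False.
Proof.
move=> a0 k0 fdf dfk fc.
pose g t := f t / t.
have gN t : 0 < t < a -> - c <= g t.
  move=> ta; have t0 : 0 < t by lra.
  rewrite /g ler_pdivlMr//; have := fc t ta.
  by rewrite ler_norml => /andP[]; lra.
have step t : 0 < t < a -> g (t / 2) <= g t - k / 2.
  move=> ta; have tt : t / 2 < t by lra.
  have gd (u : R) : t / 2 <= u <= t -> is_derive u 1 g ((df u - f u / u) / u).
    by move=> ?; apply: is_derive_div_id; [lra | apply: fdf; lra].
  have [u||u] := @MVT _ g (fun u => (df u - f u / u) / u) _ _ tt.
  - by rewrite in_itv/= => ?; apply: gd; lra.
  - apply: derivable_within_continuous => u; rewrite in_itv/= => /gd gu.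
    exact: ex_derive.
  rewrite in_itv/= => ut gE.
  have u0 : 0 < u by lra.
  have : k / u * (t - t / 2) <= g t - g (t / 2).
    rewrite gE ler_pM2r; last by lra.
    have : f u / u + k <= df u by apply: dfk; lra.
    by rewrite ler_pM2r ?invr_gt0//; lra.
  have : k / 2 <= k / u * (t - t / 2).
    by rewrite -mulrA ler_pM2l// [leRHS]mulrC ler_pdivlMr//; lra.
  by lra.
(* The exponent [j.+1] keeps even the first point strictly below [a]. *)
pose h (j : nat) := a / 2 ^+ j.+1.
have hj j : 0 < h j < a.
  rewrite /h divr_gt0 ?exprn_gt0//= ltr_pdivrMr ?exprn_gt0// ltr_pMr//.
  by rewrite exprn_egt1// ltr1n.
have gj j : g (h j) <= g (h 0%N) - j%:R * (k / 2).
  elim: j => [|j IH]; first by rewrite mul0r subr0.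
  have -> : h j.+1 = h j / 2 by rewrite /h [in LHS]exprSr invfM mulrA.
  have := step _ (hj j); move: IH; rewrite -[j.+1%:R]natr1 mulrDl mul1r.
  by set r := _%:R * (k / 2); lra.
pose j := Num.trunc ((g (h 0%N) + c) / (k / 2)).
have : (g (h 0%N) + c) / (k / 2) < j.+1%:R by exact: truncnS_gt.
rewrite ltr_pdivrMr; last by lra.
have := gj j.+1; have := gN _ (hj j.+1).
by set r := _%:R * (k / 2); lra.
Qed.

(** This keeps a trajectory on its side of a wall as time runs back towards 0. *)
Lemma derivable_neq0_gt0 (f : R -> R) (a : R) :
  (forall s : R, 0 < s <= a -> derivable f s 1) -> (forall s : R, 0 < s <= a -> f s != 0) ->
  0 < f a -> forall s, 0 < s <= a -> 0 < f s.
Proof.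
move=> fd fn0 fa s sa; rewrite ltNge; apply/negP => fs.
have [|||t tI ft] := @IVT _ f s a 0; first by lra.
- apply: derivable_within_continuous => t; rewrite in_itv/= => ?.
  by apply: fd; lra.
- by rewrite ge_min fs/= le_max (ltW fa) orbT.
by have := fn0 t; rewrite ft eqxx; move: tI; rewrite in_itv/=; lra.
Qed.

End RealDerivatives.

(** * The network *)

Section Clamp.
Context {R : realType}.
Implicit Types c a r : R.

Lemma clamp_id c a : `|a| <= c -> clamp c a = a.
Proof.
by rewrite ler_norml => /andP[ca ac]; rewrite /clamp max_l// min_l.
Qed.

Lemma clamp_ge c a r : r <= a -> r <= c -> r <= clamp c a.
Proof. by move=> ra rc; rewrite /clamp le_min le_max ra rc. Qed.

Lemma norm_clamp_le c a : 0 <= c -> `|clamp c a| <= c.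
Proof.
move=> c0; rewrite ler_norml /clamp le_min le_max lexx orbT ge_min lexx orbT.
by rewrite andbT/=; lra.
Qed.

End Clamp.

Section Network.
Context {R : realType} {m n : nat} {I : finType}.
Variables (c : R) (G H : I -> 'cV[R]_(m + (n + 1) + 1) -> R).
Implicit Types (i j : I) (s w : R) (v : 'cV[R]_(m + (n + 1) + 1)).

(** The successor puts every centre at 1 or above, leaving the ratios below [1 / 2] to [base]. *)
Definition slot i : R := (enum_rank i).+1%:R.

Definition base s w : R := Num.max 0 (s / 2 - w).

Definition tent i s w : R :=
  Num.max 0 (Num.min (w - (slot i - 1 / 2) * s) ((slot i + 1 / 2) * s - w)).

(** For [s > 0] the supports of [base] and of the tents are disjoint, so [push v / gate v] is
    [c + 1] below the slots and [G i v / H i v] inside slot [i] where [H i v > 0]. *)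
Definition gate v : R := base (s_coord v) (w_coord v) +
  \sum_i tent i (s_coord v) (w_coord v) * Num.max 0 (H i v).

Definition push v : R := (c + 1) * base (s_coord v) (w_coord v) +
  \sum_i tent i (s_coord v) (w_coord v) * G i v.

Definition last_ord : 'I_(n + 1) := rshift n ord0.

(* Where [gate v != 0] the field is [u / s], plus [push v / gate v] on [w]. *)
Definition net_mx v : 'M[R]_(n + 1) := (s_coord v * gate v)%:M.

Definition net_rhs v : 'cV[R]_(n + 1) :=
  gate v *: dsubmx (usubmx v) + (s_coord v * push v) *: delta_mx last_ord ord0.

Lemma isdnet_net : (forall i, isd (G i)) -> (forall i, isd (H i)) ->
  isdnet net_mx net_rhs.
Proof.
move=> IG IH; have Is := @isd_s_coord R m n; have Iw := @isd_w_coord R m n.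
have Isub f g : isd f -> isd g -> isd (fun v => f v - g v).
  by move=> If Ig; exact/isd_add/isd_opp.
have Ibase : isd (fun v => base (s_coord v) (w_coord v)).
  apply: isd_max; first exact: isd_const.
  by apply: Isub => //; apply: isd_mul => //; exact: isd_const.
have Itent i : isd (fun v => tent i (s_coord v) (w_coord v)).
  apply: isd_max; first exact: isd_const.
  by apply: isd_min; apply: Isub => //; apply: isd_mul => //; exact: isd_const.
have Igate : isd gate.
  apply: isd_add => //; apply: isd_sum => i; apply: isd_mul => //.
  exact/isd_max/IH/isd_const.
have Ipush : isd push.
  apply: isd_add; first exact/isd_mul/Ibase/isd_const.
  by apply: isd_sum => i; exact: isd_mul.
split=> [i j|i].
  apply: (@eq_isd _ _ _ (fun v => s_coord v * gate v * (i == j)%:R)).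
    by move=> v; rewrite mxE mulr_natr.
  by apply: isd_mul; [exact: isd_mul | exact: isd_const].
apply: (@eq_isd _ _ _ (fun v => gate v * v (lshift _ (rshift _ i)) ord0 +
   s_coord v * push v * ((i == last_ord) && (ord0 == ord0 :> 'I_1))%:R)).
  by move=> v; rewrite !mxE.
apply: isd_add; first exact/isd_mul/isd_coord.
by apply: isd_mul; [exact: isd_mul | exact: isd_const].
Qed.

Lemma slot_ge1 i : 1 <= slot i.
Proof. by rewrite /slot ler1n. Qed.

Lemma slot_le_card i : slot i <= #|I|%:R.
Proof. by rewrite /slot ler_nat. Qed.

Lemma slot_discrete i j : slot i <= slot j \/ slot j + 1 <= slot i.
Proof.
rewrite /slot natr1 !ler_nat; case: (leqP (enum_rank i).+1 (enum_rank j).+1) => ?.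
  by left.
by right.
Qed.

Lemma slot_inj : injective slot.
Proof.
by move=> i j /eqP; rewrite /slot eqr_nat eqSS => /eqP/val_inj/enum_rank_inj.
Qed.

Lemma tent_ge0 i s w : 0 <= tent i s w.
Proof. by rewrite /tent le_max lexx. Qed.

Lemma tent_gt0 i s w :
  (0 < tent i s w) = ((slot i - 1 / 2) * s < w < (slot i + 1 / 2) * s).
Proof. by rewrite /tent lt_max ltxx lt_min !subr_gt0. Qed.

Lemma tent_eq0 i s w : ~~ ((slot i - 1 / 2) * s < w < (slot i + 1 / 2) * s) ->
  tent i s w = 0.
Proof.
by rewrite -tent_gt0 -leNgt => ti; apply/eqP; rewrite eq_le ti tent_ge0.
Qed.

Lemma gate_base v : 0 < s_coord v -> w_coord v < s_coord v / 2 ->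
  0 < gate v /\ push v = (c + 1) * gate v.
Proof.
move=> s0 ws; have t0 i : tent i (s_coord v) (w_coord v) = 0.
  apply: tent_eq0; apply/negP => /andP[+ _]; have := slot_ge1 i.
  by nra.
rewrite /gate /push !big1 => [|i _|i _]; rewrite ?t0 ?mul0r// !addr0.
by split=> //; rewrite /base lt_max subr_gt0 ws orbT.
Qed.

(** Distinct slots have centres at least 1 apart and half-width [1 / 2], so only the term of index
    [i] survives. *)
Lemma gate_tent i v : 0 < s_coord v -> 0 < tent i (s_coord v) (w_coord v) ->
  gate v = tent i (s_coord v) (w_coord v) * Num.max 0 (H i v) /\
  push v = tent i (s_coord v) (w_coord v) * G i v.
Proof.
move=> s0; have i1 := slot_ge1 i => t0.
have b0 : base (s_coord v) (w_coord v) = 0.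
  move: t0; rewrite tent_gt0 => /andP[t1 t2].
  by rewrite /base max_l// subr_le0; nra.
have tj j : j != i -> tent j (s_coord v) (w_coord v) = 0.
  move=> ji; apply: tent_eq0; move: t0; rewrite tent_gt0 => /andP[t1 t2].
  apply/negP => /andP[t3 t4].
  have [ij|ij] := slot_discrete i j; last by nra.
  have [ij'|ij'] := slot_discrete j i; last by nra.
  by move/eqP: ji; apply; apply: slot_inj; lra.
rewrite /gate /push b0 mulr0 !add0r (bigD1 i)//= (bigD1 (P := predT) i)//=.
rewrite !big1 ?addr0// => j ji; first by rewrite tj// mul0r.
by rewrite tj// mul0r.
Qed.

Lemma gate_neq0 v : 0 < s_coord v -> gate v != 0 ->
  w_coord v < s_coord v / 2 \/
  exists2 i, 0 < tent i (s_coord v) (w_coord v) & 0 < H i v.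
Proof.
move=> s0 g0; have [|sw] := ltP (w_coord v) (s_coord v / 2); first by left.
right; apply: contrapT => noi; move/eqP: g0; apply.
rewrite /gate /base max_l ?subr_le0// add0r big1// => i _.
have [t0|t0] := leP (tent i (s_coord v) (w_coord v)) 0.
  suff -> : tent i (s_coord v) (w_coord v) = 0 by rewrite mul0r.
  by apply/eqP; rewrite eq_le t0 tent_ge0.
rewrite max_l ?mulr0// leNgt; apply/negP => Hi; apply: noi.
by exists i.
Qed.

Lemma net_field x u s : 0 < s -> let v := net_input x u s in
  clamp_sol c (net_mx v) (net_rhs v) = if gate v == 0 then 0 else
    map_mx (clamp c) (s^-1 *: u + (push v / gate v) *: delta_mx last_ord ord0).
Proof.
move=> s0 v; have sv : s_coord v = s by exact: s_coordE.
have sN0 : s != 0 by rewrite gt_eqF.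
(* The determinant is [(s * gate v) ^+ (n + 1)]; as the exponent is positive, it vanishes exactly
   when [gate v] does. *)
have n1 : (0 < n + 1)%N by rewrite addn1.
rewrite /clamp_sol /net_mx unitmxE det_scalar unitfE expf_eq0 n1/= sv.
rewrite mulf_eq0 (negbTE sN0)/=; case: eqP => //= /eqP g0.
rewrite invmx_scalar mul_scalar_mx /net_rhs sv /v /net_input col_mxKu col_mxKd.
congr map_mx; rewrite scalerDr !scalerA; congr (_ *: _ + _ *: _).
  by field; rewrite sN0 g0.
by field; rewrite sN0 g0.
Qed.

End Network.

Arguments slot R {I} i.
Arguments last_ord n : clear implicits.
Arguments slot_ge1 R {I} i.
Arguments slot_le_card R {I} i.
Arguments slot_discrete R {I} i j.

(** * Existence and uniqueness of the solution *)

Section Correctness.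
Context {R : realType} {m n : nat} {I : finType}.
Variables (c : R) (F : 'cV[R]_m -> 'cV[R]_n).
Variables (g h : I -> 'cV[R]_(m + n) -> R) (a b : I -> nat).
Variables (G H : I -> 'cV[R]_(m + (n + 1) + 1) -> R).
Hypothesis c_ge : #|I|%:R + 1 <= c.
Hypothesis F_le : forall x i, `|F x i ord0| <= c.
Hypothesis g_ge0 : forall i v, 0 <= g i v.
Hypothesis F_graph : forall x y,
  F x = y <-> exists i, g i (col_mx x y) = 0 /\ 0 < h i (col_mx x y).
Hypothesis G_hom : forall i, homogenises (a i) (G i) (g i).
(* The extra factor [s ^+ a i] makes [G i / H i >= g i / h i] for [s <= 1]. *)
Hypothesis H_hom : forall i, homogenises (a i + b i) (H i) (h i).

Let M := net_mx H.
Let rhs := net_rhs c G H.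
Let c_ge1 : 1 <= c. Proof. by rewrite (le_trans _ c_ge)// lerDr. Qed.
Let c_ge0 : 0 <= c. Proof. exact: le_trans c_ge1. Qed.
(** In slot [i] the ratio is below [slot i + 1 / 2], so a speed exceeding it by at most [1 / 2]
    stays under the clamp. *)
Let slot_le (i : I) : slot R i + 1 <= c.
Proof. by rewrite (le_trans _ c_ge)// lerD2r slot_le_card. Qed.

Lemma net_solution x : exists z, sann_solution M rhs x c z.
Proof.
have [i [gi hi]] := (F_graph x (F x)).1 erefl.
pose C : 'cV[R]_(n + 1) := col_mx (F x) (const_mx (slot R i)).
exists (fun s => s *: C); split; first by rewrite scale0r.
  by apply: continuous_subspaceT => s; exact: scalel_continuous.
move=> s /andP[s0 s1]; set v := net_input x _ s.
have sN0 : s != 0 by rewrite gt_eqF.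
have sv : s_coord v = s by exact: s_coordE.
have wv : w_coord v = s * slot R i by rewrite w_coordE linearZ/= col_mxKd !mxE.
have yv : s^-1 *: usubmx (s *: C) = F x.
  by rewrite linearZ/= scalerA mulVf// scale1r col_mxKu.
have t0 : 0 < tent i (s_coord v) (w_coord v).
  by rewrite tent_gt0 sv wv; apply/andP; split; nra.
have Gi : G i v = 0 by rewrite G_hom// yv gi mulr0.
have Hi : 0 < H i v by rewrite H_hom// yv mulr_gt0// exprn_gt0.
have sv0 : 0 < s_coord v by rewrite sv.
have [gateE pushE] := gate_tent c G H sv0 t0.
rewrite net_field// -/v gateE pushE Gi mulr0 mul0r scale0r addr0.
rewrite max_r ?(ltW Hi)// mulf_eq0 !gt_eqF//= scalerA mulVf// scale1r.
(* Along the line the perturbation is 0, and the entries of [C], namely those of [F x] and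
   [slot R i], are within the clamp. *)
suff -> : map_mx (clamp c) C = C by exact: is_derive_linear.
apply/matrixP => j k; rewrite mxE clamp_id// ord1.
rewrite -(splitK j); case: (fintype.split j) => l /=.
  by rewrite col_mxEu.
rewrite col_mxEd mxE ger0_norm ?ler0n//.
by have := slot_le i; lra.
Qed.

Section Uniqueness.
Variables (x : 'cV[R]_m) (z : R -> 'cV[R]_(n + 1)).
Hypothesis z_sol : sann_solution M rhs x c z.
Implicit Types s d t : R.

Let v s := net_input x (z s) s.
Let w s : R := z s (last_ord n) ord0.
Let D s := clamp_sol c (M (v s)) (rhs (v s)).
Let gt s := gate H (v s).
Let pt s := push c G (v s).

Let sv s : s_coord (v s) = s. Proof. exact: s_coordE. Qed.
Let wv s : w_coord (v s) = w s. Proof. by rewrite w_coordE !mxE. Qed.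

Let z_derive i s : 0 < s < 1 ->
  is_derive s 1 (fun t => z t i ord0) (D s i ord0).
Proof. by case: z_sol => _ _ zd /zd; exact: is_derive_coord. Qed.

Let D_le s i : `|D s i ord0| <= c.
Proof.
rewrite /D /clamp_sol; case: ifP => _; rewrite mxE.
  exact: norm_clamp_le.
by rewrite normr0.
Qed.

Let z_continuous i : {within `[0, 1], continuous (fun t => z t i ord0)}.
Proof. by case: z_sol => _ zc _; exact: continuous_within_coord. Qed.

Let z0 i : z 0 i ord0 = 0.
Proof. by case: z_sol => -> _ _; rewrite mxE. Qed.

Let z_le i s : 0 < s < 1 -> `|z s i ord0| <= c * s.
Proof.
apply: (derive_bounded_le (z0 i) (@z_continuous i) (@z_derive i)) => t _.
exact: D_le.
Qed.

(** The clamp bounds the speed, hence the ratio; consequently it does not alter [z / s] in the first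
    [n] coordinates of the field. *)
Let ratio_le i s : 0 < s < 1 -> `|z s i ord0 / s| <= c.
Proof.
move=> s01; have s0 : 0 < s by lra.
by rewrite normrM normfV (gtr0_norm s0) ler_pdivrMr// z_le.
Qed.

Let D_gate0 s i : 0 < s < 1 -> gt s = 0 -> D s i ord0 = 0.
Proof.
by move=> s01 /eqP g0; rewrite /D /M /rhs net_field ?[_ == 0]g0 ?mxE//; lra.
Qed.

Let D_w s : 0 < s < 1 -> gt s != 0 ->
  D s (last_ord n) ord0 = clamp c (w s / s + pt s / gt s).
Proof.
move=> s01 g0; rewrite /D /M /rhs net_field; last by lra.
by rewrite (negbTE g0) !mxE !eqxx mulr1 mulrC.
Qed.

Let D_z s i : 0 < s < 1 -> gt s != 0 ->
  D s (lshift 1 i) ord0 = z s (lshift 1 i) ord0 / s.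
Proof.
move=> s01 g0; rewrite /D /M /rhs net_field; last by lra.
rewrite (negbTE g0) !mxE eq_lrshift mulr0 addr0 mulrC.
by rewrite clamp_id// ratio_le.
Qed.

(** Here [w s / s] lies between [- c] and [1 / 2], so adding [c + 1] gives at least 1, and both
    lower bounds survive the clamp because [c >= 1]. *)
Let base_speed s : 0 < s < 1 -> w s < s / 2 ->
  [/\ gt s != 0, 1 / 2 <= D s (last_ord n) ord0 &
      w s / s + 1 / 2 <= D s (last_ord n) ord0].
Proof.
move=> s01 ws; have s0 : 0 < s by lra.
have c1 := c_ge1.
have [||g0 pE] := @gate_base _ _ _ _ c G H (v s); rewrite ?sv ?wv//.
have gN0 : gt s != 0 by rewrite gt_eqF.
have := ratio_le (last_ord n) s01; rewrite ler_norml -/(w s) => /andP[r1 r2].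
have r3 : w s / s < 1 / 2 by rewrite ltr_pdivrMr//; lra.
have -> : D s (last_ord n) ord0 = clamp c (w s / s + (c + 1)).
  by rewrite D_w// /pt pE mulfK.
by split=> //; apply: clamp_ge; lra.
Qed.

Let tent_speed s i : 0 < s < 1 -> 0 < tent i s (w s) -> 0 < H i (v s) ->
  1 / 2 <= D s (last_ord n) ord0 /\
  w s / s + Num.min (1 / 2) (G i (v s) / H i (v s)) <= D s (last_ord n) ord0.
Proof.
move=> s01 t0 H0; have s0 : 0 < s by lra.
have c1 := c_ge1.
have [||gE pE] := @gate_tent _ _ _ _ c G H i (v s); rewrite ?sv ?wv//.
rewrite sv wv max_r ?ltW// in gE; rewrite sv wv in pE.
have gN0 : gt s != 0 by rewrite /gt gE mulf_neq0// gt_eqF.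
have r0 : 0 <= G i (v s) / H i (v s).
  by rewrite divr_ge0 ?(ltW H0)// G_hom// mulr_ge0// exprn_ge0// ltW.
have -> : D s (last_ord n) ord0 = clamp c (w s / s + G i (v s) / H i (v s)).
  by rewrite D_w// /pt /gt pE gE -mulf_div divff ?mul1r// gt_eqF.
move: t0; rewrite tent_gt0 => /andP[t1 t2].
have i1 := slot_ge1 R i; have i2 := slot_le i.
have r1 : slot R i - 1 / 2 < w s / s by rewrite ltr_pdivlMr.
have r2 : w s / s < slot R i + 1 / 2 by rewrite ltr_pdivrMr.
(* The cap [1 / 2] keeps [w s / s + k] below [slot R i + 1], hence below [c]. *)
set k := Num.min _ _.
have k1 : k <= 1 / 2 by rewrite ge_min lexx.
have k2 : k <= G i (v s) / H i (v s) by rewrite ge_min lexx orbT.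
by split; apply: clamp_ge; lra.
Qed.

Let D_speed s : 0 < s < 1 -> gt s != 0 -> 1 / 2 <= D s (last_ord n) ord0.
Proof.
move=> s01 g0; have [|ws|[i]] := gate_neq0 _ g0; first by rewrite sv; lra.
  by rewrite sv wv in ws; have [] := base_speed s01 ws.
by rewrite sv wv => t0 H0; have [] := tent_speed s01 t0 H0.
Qed.

(* By Darboux, [w'] cannot take both the value 0 and values above 1/2. *)
Let gate_solution s : 0 < s < 1 -> gt s != 0.
Proof.
move=> s01; apply/eqP => g0.
have D0 t : 0 < t < 1 -> D t (last_ord n) ord0 = 0.
  move=> t01; have [gt0|/(D_speed t01) Dt] := eqVneq (gt t) 0.
    exact: D_gate0.
  (* The value [1 / 4] lies in the gap between 0 and [1 / 2], which [w'] never enters. *)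
  have [||||r] := @darboux _ w (fun t => D t (last_ord n) ord0) `]0, 1[ _ s t (1 / 4).
  - by move=> r; rewrite in_itv/=; exact: z_derive.
  - by rewrite in_itv.
  - by rewrite in_itv.
  - by rewrite D_gate0//; lra.
  rewrite in_itv/= => r01; have [/(D_gate0 (last_ord n) r01)->|/(D_speed r01)] := eqVneq (gt r) 0.
    by lra.
  by lra.
(* With [w'] identically 0, [w s] is 0, which lies below all the slots, where the gate is
   nonzero. *)
have w0 : `|w s| <= 0 * s.
  apply: (derive_bounded_le (z0 _) (@z_continuous _) (@z_derive _)) => // t t01.
  by rewrite D0// normr0.
have ws : w s < s / 2.
  by move: w0; rewrite mul0r normr_le0 => /eqP ->; lra.
by have [/eqP] := base_speed s01 ws.
Qed.

(** As the gate never vanishes, [z' = z / s] on the whole open interval; the constant ratio is the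
    output at time 1. *)
Let ratio_const s : 0 < s < 1 -> s^-1 *: usubmx (z s) = usubmx (z 1).
Proof.
move=> s01; have s0 : 0 < s by lra.
apply/matrixP => i k; rewrite !mxE ord1.
rewrite (eq_ratio (z0 (lshift 1 i)) (@z_continuous _) _ (s := s)); last by lra.
  by rewrite mulKf// gt_eqF.
by move=> t t01; rewrite -D_z ?gate_solution//; exact: z_derive.
Qed.

(* [w] stays in its slot: at a wall between two slots the gate vanishes. *)
Let no_wall s d : 0 < s < 1 -> 1 / 2 <= d ->
  (forall j : I, slot R j <= d - 1 / 2 \/ d + 1 / 2 <= slot R j) -> w s - d * s != 0.
Proof.
move=> s01 d1 dj; apply/eqP => wd; have s0 : 0 < s by lra.
have [||[i]] := gate_neq0 _ (gate_solution s01); rewrite sv// wv; first by nra.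
by rewrite tent_gt0 => /andP[t1 t2] _; have [ij|ij] := dj i; nra.
Qed.

Let wall_derivable d s : 0 < s <= 1 / 2 -> derivable (fun t => w t - d * t) s 1.
Proof.
move=> s01; have ws : is_derive s 1 w (D s (last_ord n) ord0).
  by apply: z_derive; lra.
have := is_deriveB ws (is_deriveZ d (is_derive_id s (1 : R))).
by case.
Qed.

Let w_derive s : 0 < s < 1 / 2 -> is_derive s 1 w (D s (last_ord n) ord0).
Proof. by move=> ?; apply: z_derive; lra. Qed.

Let w_le s : 0 < s < 1 / 2 -> `|w s| <= c * s.
Proof. by move=> ?; apply: z_le; lra. Qed.

Lemma net_unique : usubmx (z 1) = F x.
Proof.
have h2 : 0 < 1 / 2 :> R by lra.
have h01 : 0 < (1 / 2 : R) < 1 by lra.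
(* The position at time [1 / 2] is propagated back to all earlier times: a wall at ratio [d] cannot
   be crossed. *)
have stay_above d : 1 / 2 <= d ->
    (forall j : I, slot R j <= d - 1 / 2 \/ d + 1 / 2 <= slot R j) ->
    d * (1 / 2) < w (1 / 2) -> forall s, 0 < s < 1 / 2 -> d * s < w s.
  move=> d1 dj wd s s2; rewrite -subr_gt0.
  apply: (derivable_neq0_gt0 (f := fun t => w t - d * t) (a := 1 / 2)); last by lra.
  - exact: wall_derivable.
  - by move=> t t2; apply: no_wall => //; lra.
  - by rewrite subr_gt0.
have stay_below d : 1 / 2 <= d ->
    (forall j : I, slot R j <= d - 1 / 2 \/ d + 1 / 2 <= slot R j) ->
    w (1 / 2) < d * (1 / 2) -> forall s, 0 < s < 1 / 2 -> w s < d * s.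
  move=> d1 dj wd s s2; rewrite -subr_gt0 -opprB.
  apply: (derivable_neq0_gt0 (f := fun t => - (w t - d * t)) (a := 1 / 2)); last by lra.
  - by move=> t t2; apply: derivableN; exact: wall_derivable.
  - by move=> t t2; rewrite oppr_eq0; apply: no_wall => //; lra.
  - by rewrite opprB subr_gt0.
have [||[i]] := gate_neq0 _ (gate_solution h01); rewrite sv// wv.
  (* Below all the slots, the wall [d = 1 / 2] confines [w], and [base_speed] supplies the excess
     [1 / 2]. *)
  move=> ws; exfalso; apply: (ratio_escape h2 h2 w_derive _ w_le) => s s2.
  have s01 : 0 < s < 1 by lra.
  have ws2 : w s < 1 / 2 * s.
    apply: stay_below => //; last by lra.
    by move=> j; right; have := slot_ge1 R j; lra.
  by have [|_ _] := base_speed s01; first by lra.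
move=> t0 H0.
have hi : 0 < h i (col_mx x (usubmx (z 1))).
  by move: H0; rewrite H_hom// ratio_const// pmulr_rgt0// exprn_gt0.
have [gi|gi] := eqVneq (g i (col_mx x (usubmx (z 1)))) 0.
  by apply/esym/F_graph; exists i.
have {}gi : 0 < g i (col_mx x (usubmx (z 1))) by rewrite lt_neqAle eq_sym gi g_ge0.
exfalso; pose r := g i (col_mx x (usubmx (z 1))) / h i (col_mx x (usubmx (z 1))).
have r0 : 0 < r by rewrite divr_gt0.
have k0 : 0 < Num.min (1 / 2) r by rewrite lt_min r0 andbT.
apply: (ratio_escape h2 k0 w_derive _ w_le) => s s2.
have s01 : 0 < s < 1 by lra.
have s0 : 0 < s by lra.
have i1 := slot_ge1 R i.
move: t0; rewrite tent_gt0 => /andP[t1 t2].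
(* The walls [slot R i - 1 / 2] and [slot R i + 1 / 2] confine [w] to slot [i]. *)
have ts : 0 < tent i s (w s).
  rewrite tent_gt0; apply/andP; split.
    apply: stay_above => //; first by lra.
    by move=> j; have [] := slot_discrete R i j; [right|left]; lra.
  apply: stay_below => //; first by lra.
  by move=> j; have [] := slot_discrete R j i; [left|right]; lra.
have Hs : 0 < H i (v s) by rewrite H_hom// ratio_const// mulr_gt0// exprn_gt0.
have [_] := tent_speed s01 ts Hs; apply: le_trans; rewrite lerD2l.
rewrite le_min ge_min lexx/= ge_min; apply/orP; right.
(* Cancelling [s ^+ a i] leaves [g i / (s ^+ b i * h i)], which is at least [r] because
   [s ^+ b i <= 1]. *)
rewrite G_hom// H_hom// ratio_const// exprD -mulrA -mulf_div divff; last first.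
  by rewrite expf_neq0// gt_eqF.
rewrite mul1r ler_pM2l// lef_pV2 ?posrE ?mulr_gt0 ?exprn_gt0//.
by rewrite ler_piMl ?(ltW hi)// exprn_ile1// ?ltW//; lra.
Qed.

End Uniqueness.

Lemma net_correct x : sann_lim_eq M rhs x c (F x).
Proof. by split; [exact: net_solution | move=> z; exact: net_unique]. Qed.

End Correctness.

(** * Assembling the network for [F] *)

Theorem mainTheorem6 (R : realType) (m n : nat) (F : 'cV[R]_m -> 'cV[R]_n) :
  semialg_fun F -> bounded_fun F ->
  exists (M : 'cV[R]_(m + (n + 1) + 1) -> 'M[R]_(n + 1))
         (b : 'cV[R]_(m + (n + 1) + 1) -> 'cV[R]_(n + 1)) (cmax : R),
    [/\ isdnet M b, 0 <= cmax &
        forall x : 'cV[R]_m, sann_lim_eq M b x cmax (F x)].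
Proof.
move=> /semialg_isd_dnf[I [g [h [Ig Ih g0 Fgh]]]].
(* Boundedness provides every bound strictly above [B0]; [B0 + 1] is one of them. *)
move=> -[B0 [_ /(_ (B0 + 1))]]; rewrite ltrDl ltr01 => /(_ isT).
move: (B0 + 1) => B FB.
have /choice[Gd GP] : forall i, exists p : nat * ('cV[R]_(m + (n + 1) + 1) -> R),
    isd p.2 /\ homogenises p.1 p.2 (g i).
  by move=> i; have [d [q ?]] := isd_homogenise (Ig i); exists (d, q).
have /choice[Hd HP] : forall i, exists p : nat * ('cV[R]_(m + (n + 1) + 1) -> R),
    isd p.2 /\ homogenises p.1 p.2 (h i).
  by move=> i; have [d [q ?]] := isd_homogenise (Ih i); exists (d, q).
pose G i := (Gd i).2.
pose H i v := s_coord v ^+ (Gd i).1 * (Hd i).2 v.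
(* The clamp must exceed both the slots and the values of [F]; the absolute value is taken because
   the sign of [B] is not known. *)
pose c := #|I|%:R + 1 + `|B|.
have c0 : 0 <= c by rewrite !addr_ge0.
exists (net_mx H), (net_rhs c G H), c; split=> //.
  apply: isdnet_net => i; first exact: (GP i).1.
  by apply: isd_mul (HP i).1; apply/isd_exp/isd_s_coord.
move=> x; apply: (@net_correct _ _ _ _ _ _ g h (fun i => (Gd i).1) (fun i => (Hd i).1)).
- by rewrite lerDl.
- move=> x' i; apply: (@le_trans _ _ `|F x'|).
    rewrite [leRHS]/Num.Def.normr/= mx_normrE.
    exact: (le_bigmax _ (fun ij => `|F x' ij.1 ij.2|) (i, ord0)).
  apply: le_trans (FB _ _) _ => //.
  by apply: le_trans (ler_norm _) _; rewrite lerDr addr_ge0.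
- exact: g0.
- by move=> x' y; rewrite -Fgh /= col_mxKu col_mxKd.
- by move=> i; exact: (GP i).2.
- by move=> i x' u s s0; rewrite /H s_coordE (HP i).2// mulrA exprD.
Qed.
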